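(* The family of GAP-rich subsets of $\mathbb{N}$ is strongly partition regular: for every GAP-rich set $A\subseteq\mathbb{N}$ and every finite partition $A=A_1\cup\dots\cup A_m$ there is $i\leq m$ such that $A_i$ is GAP-rich.
   Context: A set $A\subseteq\mathbb{N}$ is GAP-rich (contains arbitrarily long geoarithmetic progressions) if for every $k\in\mathbb{N}$ there are $r,a,b\in\mathbb{N}$ with $r>1$ and $b>0$ such that $r^{i}(a+jb)\in A$ for all $1\leq i,j\leq k$. *)

(* Defs.v *)
From mathcomp Require Import all_boot.
From mathcomp Require Import classical_sets.

Set Implicit Arguments.
Unset Strict Implicit.
Unset Printing Implicit Defensive.

Local Open Scope classical_set_scope.

Definition gap_rich (A : set nat) : Prop :=
  forall k : nat, exists r a b : nat,
    [/\ 1 < r, 0 < b &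
        forall i j : nat, 1 <= i <= k -> 1 <= j <= k -> A (r ^ i * (a + j * b))].

Definition strongly_partition_regular (T : Type) (P : set (set T)) : Prop :=
  forall A : set T, P A ->
  forall (m : nat) (F : 'I_m -> set T),
    classical_sets.partition [set: 'I_m] F A -> exists i : 'I_m, P (F i).

(* Main.v *)
(** Passing to arithmetic progressions in both indices of a geoarithmetic
    progression again gives one:
      r^(i0 + i d) (a + (j0 + j e) b)
        = (r^d)^i (r^i0 (a + j0 b) + j (r^i0 e b)).
    So it suffices that every finite colouring of a large enough square grid of
    indices has a monochromatic product of two progressions of length k.  This
    follows from van der Waerden's theorem applied twice: first to the colouring
    of an index i by its whole row, then to the row common to the indices found.
    Van der Waerden's theorem itself is proved by colour focusing. *)
Require Import Defs.
From mathcomp Require Import all_boot.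
From mathcomp Require Import boolp classical_sets.
From mathcomp Require Import zify ring.

Set Implicit Arguments.
Unset Strict Implicit.
Unset Printing Implicit Defensive.

Definition mono_ap (C : Type) (f : nat -> C) (k N : nat) : Prop :=
  exists a d, [/\ a <= N, 0 < d <= N & forall j, j < k -> f (a + j * d) = f a].

(* [s] progressions of length [k], of pairwise distinct colours, that would all
   be continued by the same point [p], which has yet another colour. *)
Definition focused (C : eqType) (f : nat -> C) (k s N : nat) : Prop :=
  exists p cs, [/\ p <= N, size cs = s, uniq (f p :: cs) &
    forall c, c \in cs -> exists a d,
      [/\ 0 < d <= N, a + k * d = p & forall j, j < k -> f (a + j * d) = c]].

Lemma mono_ap_window (C : finType) (k L M : nat) (f : nat -> C) :
  mono_ap (fun x => [ffun i : 'I_L.+1 => f (x + i)]) k M ->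
  exists x D, [/\ x <= M, 0 < D <= M &
    forall j i, j < k -> i <= L -> f (x + j * D + i) = f (x + i)].
Proof.
move=> [x [D [xM DM H]]]; exists x, D; split=> // j i jk iL.
have /ffunP/(_ (inord i)) := H j jk.
by rewrite !ffunE inordK.
Qed.

(** Induction on [s]: colouring points by whole windows yields [k] equally coloured windows at
    distance [D]. Adding [D] to the difference of each progression focused at [p], and taking the
    copies of [p] as one more progression, focuses all of them at the copy of [p] one step [D]
    further. *)
Lemma focusing (k : nat) (C : finType) :
  (forall C' : finType, exists M, forall g : nat -> C', mono_ap g k M) ->
  forall s, exists N, forall f : nat -> C, mono_ap f k.+1 N \/ focused f k s N.
Proof.
move=> vdWk; elim=> [|s [N IHs]].
  by exists 0 => f; right; exists 0, [::].
have [M HM] := vdWk {ffun 'I_N.+1 -> C}.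
exists (M + k * M + N) => f.
have [x [D [xM /andP[D0 DM] win]]] :=
  mono_ap_window (HM (fun x => [ffun i : 'I_N.+1 => f (x + i)])).
have kDM : k * D <= k * M by rewrite leq_mul2l DM orbT.
have [[a [d [aN /andP[d0 dN] H]]]|[p [cs [pN szcs ucs H]]]] :=
    IHs (fun y => f (x + y)).
  left; exists (x + a), d; split; [lia|lia|].
  by move=> j jk; rewrite -addnA H.
set q := x + k * D + p; pose cs' := f (x + p) :: cs.
have Hcs' c : c \in cs' -> exists a d, [/\ 0 < d <= M + k * M + N,
    a + k * d = q & forall j, j < k -> f (a + j * d) = c].
  rewrite inE => /orP[/eqP->|/H[a [d [/andP[d0 dN] ep Hf]]]].
    exists (x + p), D; split; [lia|rewrite /q; lia|].
    by move=> j jk; rewrite addnAC win.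
  exists (x + a), (D + d); split; [lia|rewrite /q; lia|move=> j jk].
  have jkd : j * d <= k * d by rewrite leq_mul2r (ltnW jk) orbT.
  rewrite -(Hf j jk) -(win j) //; last lia.
  by congr f; lia.
(* If the new focus repeats a colour of [cs'], it prolongs the progression of that colour to length
   [k.+1]. *)
have [fq|fq] := boolP (f q \in cs').
  left; have [a [d [dN eq_q Hf]]] := Hcs' _ fq.
  have Hq j : j <= k -> f (a + j * d) = f q.
    by rewrite leq_eqVlt => /orP[/eqP->|/Hf//]; rewrite eq_q.
  exists a, d; split=> //; first by rewrite /q in eq_q; lia.
  by move=> j jk; rewrite Hq // -(Hq 0) // mul0n addn0.
right; exists q, cs'; split=> //=; first by rewrite /q; lia.
- by rewrite szcs.
- by rewrite fq.
Qed.

Theorem van_der_Waerden (k : nat) (C : finType) :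
  exists N, forall f : nat -> C, mono_ap f k N.
Proof.
elim: k C => [|k IHk] C.
  by exists 1 => f; exists 0, 1.
(* Focusing [#|C|] progressions would require [#|C|.+1] distinct colours. *)
have [N HN] := focusing C IHk #|C|.
exists N => f; have [//|[p [cs [_ szcs ucs _]]]] := HN f.
by have := max_card (mem (f p :: cs)); rewrite (card_uniqP ucs) /= szcs ltnn.
Qed.

Lemma grid_van_der_Waerden (k : nat) (C : finType) :
  exists N, forall f : nat -> nat -> C, exists a d b e,
    [/\ a + k * d <= N, b + k * e <= N, 0 < d, 0 < e &
        forall i j, i < k -> j < k -> f (a + i * d) (b + j * e) = f a b].
Proof.
(* Rows are cut at [L], which bounds every term of a progression given by [H1]. *)
have [N1 H1] := van_der_Waerden k C; pose L := N1 + k * N1.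
have [N2 H2] := van_der_Waerden k {ffun 'I_L.+1 -> C}.
exists (L + (N2 + k * N2)) => f.
have [a [d [aN /andP[d0 dN] Hi]]] := H2 (fun i => [ffun j : 'I_L.+1 => f i j]).
have [b [e [bN /andP[e0 eN] Hj]]] := H1 (f a).
have kd : k * d <= k * N2 by rewrite leq_mul2l dN orbT.
have ke : k * e <= k * N1 by rewrite leq_mul2l eN orbT.
exists a, d, b, e; split=> //; [lia|rewrite /L; lia|move=> i j ik jk].
have je : j * e <= k * e by rewrite leq_mul2r (ltnW jk) orbT.
have jL : b + j * e < L.+1 by rewrite /L; lia.
have /ffunP/(_ (Ordinal jL)) := Hi i ik.
by rewrite !ffunE /= => ->; exact: Hj.
Qed.

Lemma gap_rich_color (A : set nat) (m : nat) (F : 'I_m -> set nat) (k : nat) :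
  gap_rich A -> (forall n, A n -> exists i, F i n) ->
  exists c r a b, [/\ 1 < r, 0 < b & forall i j, 1 <= i <= k -> 1 <= j <= k ->
    F c (r ^ i * (a + j * b))].
Proof.
(* The colour [None] marks numbers in no class. Length [k.+1] gives the offsets 0 to [k], hence the
   required 1 to [k]. *)
move=> Arich AF; have [N HN] := grid_van_der_Waerden k.+1 (option 'I_m).
have [r [a [b [r1 b0 HA]]]] := Arich N.+1.
pose col n := [pick i | `[< F i n >]].
pose pt i j := r ^ i.+1 * (a + j.+1 * b).
have [i0 [d [j0 [e [iN jN d0 e0 Hc]]]]] := HN (fun i j => col (pt i j)).
have colP n c : col n = Some c -> F c n.
  by rewrite /col; case: pickP => // i /asboolP Fin [<-].
(* Only the corner has to be placed in [A]: the other points share its colour, hence its class. *)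
have [c col0] : exists c, col (pt i0 j0) = Some c.
  have [|i Fi] := AF (pt i0 j0); first by apply: HA; lia.
  by rewrite /col; case: pickP => [c _|/(_ i)/asboolP//]; exists c.
exists c, (r ^ d), (r ^ i0.+1 * (a + j0.+1 * b)), (r ^ i0.+1 * e * b); split.
- by rewrite -(exp1n d) ltn_exp2r.
- by rewrite !muln_gt0 e0 b0 expn_gt0 (ltnW r1).
move=> i j /andP[_ ik] /andP[_ jk].
have := colP _ _ (etrans (Hc i j ik jk) col0).
congr (F c _); rewrite /pt -addSn expnD (mulnC i d) expnM; ring.
Qed.

Lemma gap_at_le (A : set nat) (k l : nat) : k <= l ->
  (exists r a b, [/\ 1 < r, 0 < b & forall i j, 1 <= i <= l -> 1 <= j <= l ->
    A (r ^ i * (a + j * b))]) ->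
  exists r a b, [/\ 1 < r, 0 < b & forall i j, 1 <= i <= k -> 1 <= j <= k ->
    A (r ^ i * (a + j * b))].
Proof.
move=> kl [r [a [b [r1 b0 H]]]]; exists r, a, b; split=> // i j hi hj.
by apply: H; lia.
Qed.

Theorem proposition6p11 : strongly_partition_regular gap_rich.
Proof.
move=> A Arich m F [FA _ _].
have AF n : A n -> exists i, F i n by rewrite -FA => -[i _ Fi]; exists i.
apply: contrapT => /forallNP noF.
(* Each class fails at some length [kk i]; the class that contains a pattern of the maximal such
   length gives the contradiction. *)
have /choice[kk Hkk] : forall i, exists k, ~ exists r a b,
    [/\ 1 < r, 0 < b & forall u v, 1 <= u <= k -> 1 <= v <= k ->
      F i (r ^ u * (a + v * b))].
  by move=> i; exact/existsNP/noF.
have [c Hc] := gap_rich_color (\max_i kk i) Arich AF.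
exact: (Hkk c (gap_at_le (leq_bigmax c) Hc)).
Qed.
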